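(* Consider the $k$-delete recoverable robust problem under budgeted uncertainty $$(\mathrm{P})\qquad \min_{x\in X}\ f^\top x+\max_{s\in S} R(x,s).$$ It can be solved as the (mixed-integer linear) problem $$(\mathrm{Q})\qquad \begin{aligned}\min_{x,\eta}\quad & f^\top x+\eta\\ \text{s.t.}\quad & \eta\ \ge\ \sum_{i=1}^n c_i^s(\nu)\,x_i-k\nu,\qquad \nu\in\mathcal V,\ s\in S(\nu),\\ & x\in X,\ \eta\in\mathbb R_{\ge 0},\end{aligned}$$ where, for all $\nu\in\mathcal V$, $$S(\nu)=\{s\in\{1,\dots,M\}: c_i^s(\nu):=\bar c_i(\nu)+\Delta c_i(\nu)\,u_i^s,\ i\in N,\ u^s\in\mathcal U_\Gamma\}.$$ That is, (P) and (Q) have the same optimal value, and $x^*\in X$ is optimal for (P) if and only if there is $\eta^*$ such that $(x^*,\eta^* )$ is optimal for (Q).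
   Context: Data: $n\ge 1$ an integer, $N=\{1,\dots,n\}$; $X\subseteq\{0,1\}^n$ nonempty; $f,\bar c,\Delta c\in\mathbb R^n_{\ge 0}$ (first-stage costs, nominal recovery costs, maximal deviations); $\Gamma,k\in\{0,\dots,n\}$. Budgeted uncertainty: $\mathcal U_\Gamma=\{u\in\{0,1\}^n:\sum_{i=1}^n u_i\le\Gamma\}=\{u^1,\dots,u^M\}$. The scenario set is $S=\{1,\dots,M\}$, where scenario $s$ has costs $c_i^s=\bar c_i+\Delta c_i u_i^s$, $i\in N$. Recovery cost: for $x\in X$, $s\in S$, $$R(x,s)=\min_y\Big\{\sum_{i=1}^n c_i^s y_i:\ y\le x,\ \sum_{i=1}^n y_i\ge\sum_{i=1}^n x_i-k,\ y\in\{0,1\}^n\Big\}.$$ Define $\mathcal V=\{0\}\cup\{\bar c_i:i\in N\}\cup\{\bar c_i+\Delta c_i:i\in N\}$. For $\nu\in\mathcal V$ and $i\in N$ let $c_i(\nu)=\min\{\Delta c_i,\nu-\bar c_i\}$, $$\bar c_i(\nu)=\begin{cases}\nu,&\nu<\bar c_i,\\ \bar c_i,&\nu\ge\bar c_i,\end{cases}\qquad \Delta c_i(\nu)=\begin{cases}0,&\nu<\bar c_i,\\ c_i(\nu),&\nu\ge\bar c_i.\end{cases}$$ Here $\Delta c_i$ without argument is the given deviation, and $\Delta c_i(\nu)$ is the function just defined (likewise for $\bar c_i$ and $\bar c_i(\nu)$). *)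

(* Defs.v *)
From HB Require Import structures.
From mathcomp Require Import all_boot all_order all_algebra.
From mathcomp Require Import reals.

Set Implicit Arguments.
Unset Strict Implicit.
Unset Printing Implicit Defensive.

Import Order.TTheory GRing.Theory Num.Theory.
Local Open Scope ring_scope.

Section Optimization.
Variables (R : realType) (T : Type) (feasible : T -> Prop) (obj : T -> R).

Definition is_minimizer (t : T) : Prop :=
  feasible t /\ forall t', feasible t' -> obj t <= obj t'.

Definition is_min_value (v : R) : Prop :=
  exists2 t, is_minimizer t & obj t = v.

End Optimization.

(* The 0/1 vectors; booleans coerce to the natural numbers 0 and 1. *)
Definition binvec (n : nat) := {ffun 'I_n -> bool}.

Definition budget_set (n Gamma : nat) : {set binvec n} :=
  [set u : binvec n | (\sum_i u i <= Gamma)%N].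

(* The index set {1, ..., M} with M the cardinality of the budget set; u^s is
   the s-th element of that set. *)
Definition scenario (n Gamma : nat) := 'I_#|budget_set n Gamma|.

Definition uvec (n Gamma : nat) (s : scenario n Gamma) : binvec n :=
  enum_val s.

Lemma budget_set0 (n Gamma : nat) : [ffun=> false] \in budget_set n Gamma.
Proof. by rewrite inE big1 // => i _; rewrite ffunE. Qed.

Definition scenario0 (n Gamma : nat) : scenario n Gamma :=
  enum_rank_in (budget_set0 n Gamma) [ffun=> false].

Section Recovery.
Variables (R : realType) (n : nat) (f cbar dc : 'I_n -> R) (k Gamma : nat).
Variable X : {set binvec n}.

Definition scen_cost (s : scenario n Gamma) (i : 'I_n) : R :=
  cbar i + dc i * (uvec s i)%:R.

(* [k] is moved to the right-hand side to avoid truncated subtraction. *)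
Definition recovery_feasible (x y : binvec n) : bool :=
  [forall i, (y i <= x i)%N] && (\sum_i x i <= \sum_i y i + k)%N.

Definition recovery_obj (s : scenario n Gamma) (y : binvec n) : R :=
  \sum_i scen_cost s i * (y i)%:R.

(* [x] is always feasible for its own recovery problem, so that the arg min
   (whose seed must be feasible) does realize the minimum. *)
Lemma recovery_feasible_refl (x : binvec n) : recovery_feasible x x.
Proof. by rewrite /recovery_feasible leq_addr andbT; apply/forallP. Qed.

Definition recovery_cost (x : binvec n) (s : scenario n Gamma) : R :=
  recovery_obj s [arg min_(y < x | recovery_feasible x y) recovery_obj s y]%O.

Definition worst_recovery_cost (x : binvec n) : R :=
  recovery_cost x [arg max_(s > scenario0 n Gamma) recovery_cost x s]%O.

Definition first_stage_cost (x : binvec n) : R := \sum_i f i * (x i)%:R.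

Definition P_feasible (x : binvec n) : Prop := x \in X.

Definition P_obj (x : binvec n) : R :=
  first_stage_cost x + worst_recovery_cost x.

Definition breakpoints : seq R :=
  0 :: codom cbar ++ codom (fun i => cbar i + dc i).

Definition cbar_at (nu : R) (i : 'I_n) : R :=
  if nu < cbar i then nu else cbar i.

Definition dc_cap (nu : R) (i : 'I_n) : R := Num.min (dc i) (nu - cbar i).

Definition dc_at (nu : R) (i : 'I_n) : R :=
  if nu < cbar i then 0 else dc_cap nu i.

Definition scen_cost_at (nu : R) (s : scenario n Gamma) (i : 'I_n) : R :=
  cbar_at nu i + dc_at nu i * (uvec s i)%:R.

(* The set S(nu) is all of {1, ..., M}: the scenarios are unchanged, only the
   costs attached to them depend on [nu]. *)
Definition Q_feasible (p : binvec n * R) : Prop :=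
  [/\ p.1 \in X, 0 <= p.2 &
      forall nu, nu \in breakpoints -> forall s : scenario n Gamma,
        \sum_i scen_cost_at nu s i * (p.1 i)%:R - k%:R * nu <= p.2].

Definition Q_obj (p : binvec n * R) : R := first_stage_cost p.1 + p.2.

End Recovery.

(* Main.v *)
Require Import Defs.
From HB Require Import structures.
From mathcomp Require Import all_boot all_order all_algebra.
From mathcomp Require Import reals.
From mathcomp Require Import ring.

Set Implicit Arguments.
Unset Strict Implicit.
Unset Printing Implicit Defensive.

Import Order.TTheory GRing.Theory Num.Theory.
Local Open Scope ring_scope.

(** Fix a scenario and write [c i] for its costs.  The recovery problem asks for
    the cheapest way of keeping all but at most [k] of the items selected by
    [x].  Paying [nu] for every dropped item instead of limiting their number
    decouples the items: each one costs [Num.min nu (c i)].  Since up to [k]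
    drops are free, the dual bound at the price [nu] is the sum of
    [Num.min nu (c i)] over the selected items, minus [k * nu].  It is a lower
    bound for every [nu >= 0] ([price_bound_le_recovery_cost]), and it is tight
    when [nu] is the cost of the most expensive item kept by a cheapest recovery
    that makes all the drops it may ([recovery_cost_le_price_bound], which rests
    on [threshold_subset]).  That
    price is one of the scenario costs, or 0 if nothing has to be kept, so it
    always lies in the finite list of breakpoints, whatever the scenario.

    The modified cost [scen_cost_at nu s i] is nothing but
    [Num.min nu (scen_cost s i)] ([scen_cost_atE]), so the constraints of the
    second problem say exactly that [eta] bounds the worst recovery cost
    ([Q_feasibleE]).  The second problem is thus the epigraph form of the first,
    and the two have the same minimizers and value ([minimizer_epigraph]). *)

(** Lowering [e] to [g y] keeps a feasible pair feasible, so every minimizer lies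
    on the graph of [g], where the two objectives agree. *)
Lemma minimizer_epigraph (R : realType) (T : Type) (D : T -> Prop)
    (a g : T -> R) (F : T * R -> Prop) (x : T) (eta : R) :
    (forall y e, F (y, e) <-> D y /\ g y <= e) ->
  is_minimizer F (fun p => a p.1 + p.2) (x, eta) <->
  is_minimizer D (fun y => a y + g y) x /\ eta = g x.
Proof.
move=> FE; split=> [[/FE[Dx gx] xmin]|[[Dx xmin] ->]].
  have Fg y : D y -> F (y, g y) by move=> Dy; apply/FE.
  have eta_g : eta = g x.
    by apply/le_anti; rewrite gx andbT -(lerD2l (a x)); apply: (xmin _ (Fg x Dx)).
  by split=> //; split=> // y Dy; rewrite -eta_g; apply: (xmin _ (Fg y Dy)).
split=> [|[y e] /FE[Dy gy]]; first exact/FE.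
by apply: le_trans (xmin y Dy) _; rewrite lerD2l.
Qed.

(** The [m] cheapest elements of [A] are separated from the others by a price
    [nu], the cost of the last element added when they are collected greedily.
    For [m = 0] the price has to be 0: with [k] free drops for fewer than
    [k] items, the dual bound at a positive price is negative, hence not tight. *)
Lemma threshold_subset (R : realType) (I : finType) (c : I -> R) (A : {set I})
    (m : nat) :
    (forall i, 0 <= c i) -> (m <= #|A|)%N ->
  exists (B : {set I}) (nu : R),
    [/\ B \subset A, #|B| = m,
        if m is 0 then nu = 0 else exists i, nu = c i,
        {in B, forall i, c i <= nu} & {in A :\: B, forall i, nu <= c i}].
Proof.
move=> c_ge0; elim: m => [_|m IHm ltmA].
  exists set0, 0; split=> //; first exact: sub0set.
  - exact: cards0.
  - by move=> i; rewrite inE.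
have [B [nu [sBA cardB _ leB geB]]] := IHm (ltnW ltmA).
have : (0 < #|A :\: B|)%N by rewrite cardsDS // cardB subn_gt0.
case/card_gt0P=> j0 j0AB.
have [i0 i0AB i0min] := arg_minP c j0AB.
have [i0A i0B] : i0 \in A /\ i0 \notin B by move: i0AB => /setDP[].
exists (i0 |: B), (c i0); split.
- by rewrite subUset sub1set i0A.
- by rewrite cardsU1 i0B cardB.
- by exists i0.
- by move=> i /setU1P[->//|/leB /le_trans]; apply; apply: geB.
- by move=> i; rewrite !inE negb_or -andbA => /and3P[_ iB iA]; apply: i0min;
    apply/setDP.
Qed.

Section PricedRecovery.
Variables (R : realType) (n : nat) (cbar dc : 'I_n -> R) (k Gamma : nat).
Variable X : {set binvec n}.
Hypotheses (cbar_ge0 : forall i, 0 <= cbar i) (dc_ge0 : forall i, 0 <= dc i).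

Lemma sum_binvec (x : binvec n) : (\sum_i x i)%N = #|[set i | x i]|.
Proof.
rewrite -sum1_card [RHS]big_mkcond; apply: eq_bigr => i _.
by rewrite inE; case: (x i).
Qed.

Lemma scen_cost_ge0 (s : scenario n Gamma) (i : 'I_n) :
  0 <= scen_cost cbar dc s i.
Proof. by rewrite addr_ge0 ?mulr_ge0. Qed.

Lemma scen_cost_breakpoint (s : scenario n Gamma) (i : 'I_n) :
  scen_cost cbar dc s i \in breakpoints cbar dc.
Proof.
rewrite /scen_cost in_cons mem_cat.
case: (uvec s i); rewrite ?mulr1 ?mulr0 ?addr0.
  by rewrite (codom_f (fun i => cbar i + dc i)) !orbT.
by rewrite codom_f orbT.
Qed.

Lemma breakpoints_ge0 (nu : R) : nu \in breakpoints cbar dc -> 0 <= nu.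
Proof.
rewrite in_cons mem_cat => /or3P[/eqP->//|/codomP[i ->]//|/codomP[i ->]].
exact: addr_ge0.
Qed.

Lemma scen_cost_atE (nu : R) (s : scenario n Gamma) (i : 'I_n) :
  scen_cost_at cbar dc nu s i = Num.min nu (scen_cost cbar dc s i).
Proof.
rewrite /scen_cost_at /cbar_at /dc_at /dc_cap /scen_cost.
have [lt_nu|le_nu] := ltP nu (cbar i).
  by rewrite mul0r addr0 min_l // (le_trans (ltW lt_nu)) // lerDl mulr_ge0.
case: (uvec s i); rewrite ?mulr1 ?mulr0 ?addr0; last by rewrite min_r.
by rewrite addr_minr addrC minC; congr Num.min; ring.
Qed.

Definition price_bound (nu : R) (x : binvec n) (s : scenario n Gamma) : R :=
  \sum_i Num.min nu (scen_cost cbar dc s i) * (x i)%:R - k%:R * nu.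

(** What a recovery [y] pays when each dropped item is charged [nu]. *)
Lemma priced_recoveryE (nu : R) (x y : binvec n) (s : scenario n Gamma) :
  \sum_i (scen_cost cbar dc s i * (y i)%:R + nu * ((x i)%:R - (y i)%:R)) =
  recovery_obj cbar dc s y + nu * ((\sum_i x i)%:R - (\sum_i y i)%:R).
Proof.
by rewrite big_split -mulr_sumr sumrB !natr_sum.
Qed.

Lemma recovery_cost_le (x y : binvec n) (s : scenario n Gamma) :
  recovery_feasible k x y ->
  recovery_cost cbar dc k x s <= recovery_obj cbar dc s y.
Proof.
rewrite /recovery_cost.
case: arg_minP => [|z _ zmin]; first exact: recovery_feasible_refl.
exact: zmin.
Qed.

(** Weak duality: an optimal recovery either keeps or drops each selected item,
    paying [c i] or [nu], so at least their minimum, and the at most [k] charges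
    for drops are refunded. *)
Lemma price_bound_le_recovery_cost (nu : R) (x : binvec n)
    (s : scenario n Gamma) :
  0 <= nu -> price_bound nu x s <= recovery_cost cbar dc k x s.
Proof.
move=> nu_ge0; rewrite /recovery_cost.
case: arg_minP => [|y /andP[/forallP le_yx card_y] _].
  exact: recovery_feasible_refl.
have le_price : \sum_i Num.min nu (scen_cost cbar dc s i) * (x i)%:R <=
    \sum_i (scen_cost cbar dc s i * (y i)%:R + nu * ((x i)%:R - (y i)%:R)).
  apply: ler_sum => i _; have := le_yx i.
  case: (x i); case: (y i) => //= _.
  - by rewrite subrr mulr0 addr0 !mulr1 ge_min lexx orbT.
  - by rewrite subr0 mulr0 add0r !mulr1 ge_min lexx.
  - by rewrite subr0 !mulr0 addr0.
rewrite lerBlDr (le_trans le_price) // priced_recoveryE lerD2l mulrC.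
by rewrite ler_wpM2r // lerBlDr addrC -natrD ler_nat.
Qed.

(** Strong duality: the recovery that keeps the cheapest items, as many as
    required, meets the dual bound at its threshold price, since the items it
    keeps cost at most that price and those it drops cost at least that. *)
Lemma recovery_cost_le_price_bound (x : binvec n) (s : scenario n Gamma) :
  exists2 nu, nu \in breakpoints cbar dc &
    recovery_cost cbar dc k x s <= price_bound nu x s.
Proof.
pose A := [set i | x i].
have [B [nu [sBA cardB nuE leB geB]]] :=
  threshold_subset (scen_cost_ge0 s) (leq_subr k #|A|).
exists nu.
  case: (#|A| - k)%N nuE => [->|_ [i ->]]; last exact: scen_cost_breakpoint.
  by rewrite mem_head.
pose y : binvec n := [ffun i => i \in B].
have sum_y : (\sum_i y i)%N = (#|A| - k)%N.
  by rewrite sum_binvec -cardB; congr #|pred_of_set _|; apply/setP=> i;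
    rewrite inE ffunE.
have y_feasible : recovery_feasible k x y.
  rewrite /recovery_feasible sum_y sum_binvec -/A addnC -leq_subLR leqnn andbT.
  apply/forallP=> i; rewrite ffunE.
  by case: (boolP (i \in B)) => // /(subsetP sBA); rewrite inE => ->.
apply: le_trans (recovery_cost_le s y_feasible) _.
have -> : price_bound nu x s = recovery_obj cbar dc s y +
    (nu * ((\sum_i x i)%:R - (\sum_i y i)%:R) - k%:R * nu).
  rewrite addrA -priced_recoveryE; congr (_ - _); apply: eq_bigr => i _.
  rewrite ffunE; have [iB|iB] := boolP (i \in B).
    have -> : x i = true by have := subsetP sBA i iB; rewrite inE.
    by rewrite subrr mulr0 addr0 min_r ?leB.
  case xi: (x i); last by rewrite subrr !mulr0 addr0.
  by rewrite subr0 mulr0 add0r min_l ?geB // !inE iB xi.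
rewrite lerDl sum_y sum_binvec -/A.
case: (leqP #|A| k) => [le_Ak|/ltnW le_kA].
  (* Nothing has to be kept, and [nuE] forces the price to be 0. *)
  by move: nuE; rewrite (eqP le_Ak) => ->; rewrite mul0r mulr0 subrr.
by rewrite natrB // opprB addrCA subrr addr0 mulrC subrr.
Qed.

Lemma worst_recovery_cost_leP (x : binvec n) (eta : R) :
  worst_recovery_cost cbar dc k Gamma x <= eta <->
  forall s : scenario n Gamma, recovery_cost cbar dc k x s <= eta.
Proof.
split=> [|le_eta]; last exact: le_eta.
rewrite /worst_recovery_cost; case: arg_maxP => // t _ tmax le_t s.
exact: le_trans (tmax s isT) le_t.
Qed.

Lemma Q_feasibleE (x : binvec n) (eta : R) :
  Q_feasible cbar dc k Gamma X (x, eta) <->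
  x \in X /\ worst_recovery_cost cbar dc k Gamma x <= eta.
Proof.
have boundE nu (s : scenario n Gamma) :
    \sum_i scen_cost_at cbar dc nu s i * (x i)%:R - k%:R * nu =
    price_bound nu x s.
  by congr (_ - _); apply: eq_bigr => i _; rewrite scen_cost_atE.
split=> [[/= Xx _ bounds]|[Xx /worst_recovery_cost_leP le_eta]].
  split=> //; apply/worst_recovery_cost_leP => s.
  have [nu nu_bp le_bound] := recovery_cost_le_price_bound x s.
  by apply: le_trans le_bound _; rewrite -boundE; apply: bounds.
split=> //= [|nu nu_bp s].
  apply: le_trans (le_eta (scenario0 n Gamma)).
  by apply: sumr_ge0 => i _; rewrite mulr_ge0 ?scen_cost_ge0.
rewrite boundE; apply: le_trans (le_eta s).
exact/price_bound_le_recovery_cost/breakpoints_ge0.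
Qed.

End PricedRecovery.

Theorem theorem1 (R : realType) (n : nat) (f cbar dc : 'I_n -> R)
    (k Gamma : nat) (X : {set binvec n})
    (hn : (1 <= n)%N) (hX : X != set0)
    (hf : forall i, 0 <= f i) (hcbar : forall i, 0 <= cbar i)
    (hdc : forall i, 0 <= dc i)
    (hk : (k <= n)%N) (hGamma : (Gamma <= n)%N) :
  (exists v : R,
      is_min_value (P_feasible X) (P_obj f cbar dc k Gamma) v /\
      is_min_value (Q_feasible cbar dc k Gamma X) (Q_obj f) v) /\
  (forall x : binvec n, x \in X ->
      (is_minimizer (P_feasible X) (P_obj f cbar dc k Gamma) x <->
       exists eta : R,
         is_minimizer (Q_feasible cbar dc k Gamma X) (Q_obj f) (x, eta))).
Proof.
have minQ x eta := minimizer_epigraph (first_stage_cost f) x eta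
  (@Q_feasibleE R n cbar dc k Gamma X hcbar hdc).
split.
  have [x0 Xx0] := set0Pn _ hX.
  have [x Xx xmin] := arg_minP (P_obj f cbar dc k Gamma) Xx0.
  have minP : is_minimizer (P_feasible X) (P_obj f cbar dc k Gamma) x by [].
  exists (P_obj f cbar dc k Gamma x); split; first by exists x.
  exists (x, worst_recovery_cost cbar dc k Gamma x) => //.
  exact/minQ.
move=> x _; split=> [minP|[eta /minQ[]//]].
by exists (worst_recovery_cost cbar dc k Gamma x); apply/minQ.
Qed.
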